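(* Let $m$ be a positive integer and $q=2^m$. Then the trinomial $F_2(X)=X^{9}\left(X^{8(q-1)}+X^{6(q-1)}+1\right)$ is a permutation polynomial of $\mathbb{F}_{q^2}$ if and only if $m$ is odd.
   Context: A polynomial $f\in\mathbb{F}_{q^2}[X]$ is a permutation polynomial of $\mathbb{F}_{q^2}$ if the map $x\mapsto f(x)$ is a bijection of $\mathbb{F}_{q^2}$. *)

(* Defs.v *)
From mathcomp Require Import all_boot all_order all_algebra all_field.
Set Implicit Arguments.
Unset Strict Implicit.
Unset Printing Implicit Defensive.
Import GRing.Theory.
Local Open Scope ring_scope.

Definition permutation_poly (F : finFieldType) (f : {poly F}) : Prop :=
  bijective (fun x : F => f.[x]).

Definition F2 (F : finFieldType) (q : nat) : {poly F} :=
  'X^9 * ('X^(8 * (q - 1)) + 'X^(6 * (q - 1)) + 1).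

(* Main.v *)
(* The nonzero values of F_2 are x^9 h(z) with h(Z) = Z^8 + Z^6 + 1 and
   z = x^(q-1), where z^q = z^(-1).  Equality of the values at x and u forces
   g(z) = g(w), where w = u^(q-1) and g(Z) = (Z^9 + Z^3 + Z) / h(Z).  In
   characteristic 2, g is the x-coordinate of multiplication by 3 on the curve
   y^2 + xy = x^3 + 1, so the numerator of g(z) - g(w) is z - w times one factor
   for each pair {R, -R} of points of order 3.  These four factors are
   parametrized by the roots of r^4 + r^3 + 1, which form two pairs conjugate over
   F_4; grouping them accordingly writes their product as a norm a^2 + ab + b^2
   from F_4.  After division by (zw)^2 both a and b lie in F_q, and b becomes
   B^2 + B + 1 with B = zw + 1/(zw) in F_q.  When m is odd, F_q contains no
   primitive cube root of unity, hence b and then a^2 + ab + b^2 are nonzero, so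
   z = w.  When m is even, a primitive cube root of unity in F_q has the same
   image as 1. *)
Require Import Defs.
From mathcomp Require Import all_boot all_order all_algebra all_field.
From mathcomp Require Import fingroup pgroup ring.
Set Implicit Arguments.
Unset Strict Implicit.
Unset Printing Implicit Defensive.
Import GRing.Theory.
Local Open Scope ring_scope.

(** [a] and [b] are written as quadratic forms in [e], [n], [d] so that dividing by [n ^+ 2] leaves
    expressions in [e / n] and [d / n] only. *)
Lemma triplication_difference (R : comNzRingType) (z w : R) :
  2 \in [pchar R] ->
  let e := (z + w) ^+ 2 in
  let n := z * w in
  let d := 1 + n ^+ 2 in
  let a := e ^+ 2 + e * n + e * d + d ^+ 2 in
  let b := d ^+ 2 + d * n + n ^+ 2 in
  (z ^+ 9 + z ^+ 3 + z) * (w ^+ 8 + w ^+ 6 + 1)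
    - (w ^+ 9 + w ^+ 3 + w) * (z ^+ 8 + z ^+ 6 + 1)
  = (z - w) * (a ^+ 2 + a * b + b ^+ 2).
Proof.
move=> char2 e n d a b.
(* Over the integers the two sides differ by [2 * (z - w) * k]. *)
pose k := (1 + n ^+ 8) + 2 * (n + n ^+ 7) + 8 * (n ^+ 2 + n ^+ 6)
  + 6 * (n ^+ 3 + n ^+ 5) + 12 * n ^+ 4
  + e * ((1 + n ^+ 6) + 2 * (n + n ^+ 5) + 4 * (n ^+ 2 + n ^+ 4) + 13 * n ^+ 3)
  + e ^+ 2 * (2 * (1 + n + n ^+ 3 + n ^+ 4) - 5 * n ^+ 2)
  + e ^+ 3 * (1 + 5 * n + n ^+ 2).
transitivity ((z - w) * (a ^+ 2 + a * b + b ^+ 2) - 2%:R * ((z - w) * k)).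
  by rewrite /k /a /b /d /n /e; ring.
by rewrite (pcharf0 char2) mul0r subr0.
Qed.

Lemma pow2_odd_mod3 (m : nat) : odd m -> (2 ^ m %% 3 = 2)%N.
Proof.
move=> om; rewrite -(odd_double_half m) om add1n expnS -mul2n expnM.
by rewrite -modnMmr -modnXm exp1n.
Qed.

Lemma pow2_even_mod3 (m : nat) : ~~ odd m -> (2 ^ m %% 3 = 1)%N.
Proof.
move=> em; rewrite -(odd_double_half m) (negbTE em) add0n -mul2n expnM.
by rewrite -modnXm exp1n.
Qed.

Lemma expr_gcdn_eq1 (R : pzRingType) (x : R) (m n : nat) :
  x ^+ m = 1 -> x ^+ n = 1 -> x ^+ gcdn m n = 1.
Proof.
move=> xm xn; case: m xm => [|m] xm; first by rewrite gcd0n.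
have [km kn Dg _] := egcdnP n (ltn0Sn m).
have: x ^+ (km * m.+1) = 1 by rewrite mulnC exprM xm expr1n.
by rewrite Dg exprD mulnC exprM xn expr1n mul1r.
Qed.

(** A root has [t ^+ 3 = 1], so [t = t ^+ q = t ^+ 2], and the quadratic collapses to 1 in
    characteristic 2. *)
Lemma frobenius_fixed_not_cube_root (F : fieldType) (q : nat) (t : F) :
  2 \in [pchar F] -> (q %% 3 = 2)%N -> t ^+ q = t -> t ^+ 2 + t + 1 != 0.
Proof.
move=> char2 q3 tq; apply/eqP=> t0.
have t3 : t ^+ 3 = 1.
  have -> : t ^+ 3 = (t - 1) * (t ^+ 2 + t + 1) + 1 by ring.
  by rewrite t0 mulr0 add0r.
have t2 : t ^+ 2 = t.
  by rewrite -[RHS]tq (divn_eq q 3) q3 exprD mulnC exprM t3 expr1n mul1r.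
by move/eqP: t0; rewrite t2 addrr_pchar2 // add0r oner_eq0.
Qed.

Lemma frobenius_fixed_norm_form (F : fieldType) (q : nat) (a b : F) :
  2 \in [pchar F] -> (q %% 3 = 2)%N -> a ^+ q = a -> b ^+ q = b -> b != 0 ->
  a ^+ 2 + a * b + b ^+ 2 != 0.
Proof.
move=> char2 q3 aq bq b0.
have -> : a ^+ 2 + a * b + b ^+ 2 = b ^+ 2 * ((a / b) ^+ 2 + a / b + 1).
  by field.
rewrite mulf_neq0 ?expf_neq0 // (frobenius_fixed_not_cube_root char2 q3) //.
by rewrite expr_div_n aq bq.
Qed.

Lemma triplication_injective (F : fieldType) (q : nat) (z w : F) :
  2 \in [pchar F] -> (q %% 3 = 2)%N ->
  (forall x y : F, (x + y) ^+ q = x ^+ q + y ^+ q) ->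
  z != 0 -> w != 0 -> z ^+ q = z^-1 -> w ^+ q = w^-1 ->
  (z ^+ 9 + z ^+ 3 + z) * (w ^+ 8 + w ^+ 6 + 1)
    = (w ^+ 9 + w ^+ 3 + w) * (z ^+ 8 + z ^+ 6 + 1) ->
  z = w.
Proof.
move=> char2 q3 qD z0 w0 zq wq /eqP.
pose e := (z + w) ^+ 2.
pose n := z * w.
pose d := 1 + n ^+ 2.
pose a := e ^+ 2 + e * n + e * d + d ^+ 2.
pose b := d ^+ 2 + d * n + n ^+ 2.
have Dab : _ - _ = (z - w) * (a ^+ 2 + a * b + b ^+ 2)
  := triplication_difference z w char2.
rewrite -subr_eq0 Dab mulf_eq0 subr_eq0 => /orP[/eqP //|].
(* These are [e / n] and [d / n]. The [q]-th power inverts [z] and [w], which leaves both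
   unchanged. *)
pose A := (z + w) ^+ 2 / (z * w).
pose B := z * w + (z * w)^-1.
have Aq : A ^+ q = A.
  by rewrite /A expr_div_n exprAC qD exprMn zq wq; field;
    rewrite ?z0 ?w0 ?oner_neq0.
have Bq : B ^+ q = B.
  by rewrite /B qD exprVn exprMn zq wq; field;
    rewrite ?z0 ?w0 ?oner_neq0.
pose a' := A ^+ 2 + A + A * B + B ^+ 2.
pose b' := B ^+ 2 + B + 1.
have a'q : a' ^+ q = a'.
  by rewrite /a' !qD [(A * B) ^+ q]exprMn !(exprAC _ 2 q) Aq Bq.
have b'q : b' ^+ q = b' by rewrite /b' 2!qD (exprAC _ 2 q) Bq expr1n.
have Da : a = (z * w) ^+ 2 * a'.
  by rewrite /a /a' /A /B /d /n /e; field; rewrite ?z0 ?w0 ?oner_neq0.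
have Db : b = (z * w) ^+ 2 * b'.
  by rewrite /b /b' /B /d /n; field; rewrite ?z0 ?w0 ?oner_neq0.
have -> : a ^+ 2 + a * b + b ^+ 2
        = (z * w) ^+ 4 * (a' ^+ 2 + a' * b' + b' ^+ 2).
  by rewrite Da Db; ring.
rewrite (mulf_eq0 ((z * w) ^+ 4)) expf_eq0 mulf_eq0 (negbTE z0) (negbTE w0) /=.
by rewrite (negbTE (frobenius_fixed_norm_form _ q3 _ _ _)) //
  (frobenius_fixed_not_cube_root char2 q3).
Qed.

(** The trinomial is the square of k(Z) = Z^4 + Z^3 + 1. If k(z) = 0, conjugating gives the
    reciprocal equation z^4 + z + 1 = 0; the difference of the two is z(z - 1)^2 modulo 2, so z = 1,
    yet k(1) = 1. *)
Lemma trinomial_unit_circle_neq0 (F : fieldType) (q : nat) (z : F) :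
  2 \in [pchar F] -> (forall x y : F, (x + y) ^+ q = x ^+ q + y ^+ q) ->
  z != 0 -> z ^+ q = z^-1 -> z ^+ 8 + z ^+ 6 + 1 != 0.
Proof.
move=> char2 qD z0 zq; apply/eqP=> h0.
have h1 : z ^+ 4 + z ^+ 3 + 1 = 0.
  apply/eqP; rewrite -sqrf_eq0.
  have -> : (z ^+ 4 + z ^+ 3 + 1) ^+ 2
    = z ^+ 8 + z ^+ 6 + 1 + 2%:R * (z ^+ 7 + z ^+ 4 + z ^+ 3) by ring.
  by rewrite h0 (pcharf0 char2) mul0r addr0.
have h2 : z ^+ 4 + z + 1 = 0.
  have -> : z ^+ 4 + z + 1 = z ^+ 4 * (z ^+ 4 + z ^+ 3 + 1) ^+ q.
    by rewrite !qD !(exprAC _ _ q) zq expr1n; field.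
  suff zero_q : 0 ^+ q = 0 :> F by rewrite h1 zero_q mulr0.
  by apply: (addrI (0 ^+ q)); rewrite -qD !addr0.
have z1 : z = 1.
  apply/eqP; rewrite -subr_eq0 -sqrf_eq0.
  have : z * (z - 1) ^+ 2 + 2%:R * (z ^+ 2 - z) = 0.
    by rewrite -[RHS]subr0 -{1}h1 -h2; ring.
  rewrite (pcharf0 char2) mul0r addr0 => /eqP.
  by rewrite mulf_eq0 (negbTE z0).
by move/eqP: h1; rewrite z1 !expr1n addrr_pchar2 // add0r oner_eq0.
Qed.

Lemma horner_F2 (F : finFieldType) (q : nat) (x : F) :
  let z := x ^+ (q - 1) in (F2 F q).[x] = x ^+ 9 * (z ^+ 8 + z ^+ 6 + 1).
Proof.
by rewrite /F2 !(hornerE, hornerXn) -!exprM ![((q - 1) * _)%N]mulnC.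
Qed.

Lemma F2_injective (F : finFieldType) (m q : nat) :
  q = (2 ^ m)%N -> #|F| = (q ^ 2)%N -> odd m ->
  injective (fun x : F => (F2 F q).[x]).
Proof.
move=> hq hF om.
have q3 : (q %% 3 = 2)%N by rewrite hq pow2_odd_mod3.
have q_gt0 : (0 < q)%N by rewrite hq expn_gt0.
have char2 : 2 \in [pchar F].
  by apply: (card_finPcharP (n := m * 2)); rewrite // hF hq expnM.
have qD (x y : F) : (x + y) ^+ q = x ^+ q + y ^+ q.
  by apply: exprDn_pchar; rewrite (eq_pnat _ (pcharf_eq char2)) hq pnatX.
have Dq (x : F) : x ^+ q = x * x ^+ (q - 1) by rewrite -exprS subn1 prednK.
have circle (x : F) : x != 0 -> (x ^+ (q - 1)) ^+ q = (x ^+ (q - 1))^-1.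
  move=> x0; have z0 : x ^+ (q - 1) != 0 by rewrite expf_neq0.
  apply: (mulfI z0); apply: (mulfI x0); rewrite divff // mulrA -Dq mulr1.
  by rewrite exprAC -Dq -exprM mulnn -hF expf_card.
have h_neq0 (x : F) : x != 0 ->
    (x ^+ (q - 1)) ^+ 8 + (x ^+ (q - 1)) ^+ 6 + 1 != 0.
  move=> x0; apply: (trinomial_unit_circle_neq0 char2 qD);
    by rewrite ?expf_neq0 ?circle.
have F2_eq0 (x : F) : ((F2 F q).[x] == 0) = (x == 0).
  apply/idP/eqP=> [|->]; last by rewrite horner_F2 expr0n mul0r.
  rewrite horner_F2 mulf_eq0 expf_eq0.
  by have [//|/h_neq0/negbTE->] := eqVneq x 0.
(* This is F_2(x)^(q-1) = g(z) with denominators cleared: x^(9q) = x^9 z^9, and z^9 h(1/z) is the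
   numerator of g. *)
have F2_conj (x : F) : x != 0 -> let z := x ^+ (q - 1) in
    (F2 F q).[x] ^+ q * (z ^+ 8 + z ^+ 6 + 1)
    = (F2 F q).[x] * (z ^+ 9 + z ^+ 3 + z).
  move=> x0 z; have z0 : z != 0 by rewrite expf_neq0.
  have zq : z ^+ q = z^-1 by apply: circle.
  rewrite horner_F2 -/z exprMn !qD (exprAC x 9 q) (exprAC z 8 q)
    (exprAC z 6 q) zq expr1n Dq -/z.
  by field.
move=> x u /= fxu.
have [x0|x0] := eqVneq x 0.
  by apply/esym/eqP; rewrite x0 -F2_eq0 -fxu F2_eq0 x0.
have f0 : (F2 F q).[x] != 0 by rewrite F2_eq0.
have u0 : u != 0 by rewrite -F2_eq0 -fxu.
have zw : x ^+ (q - 1) = u ^+ (q - 1).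
  apply: (triplication_injective char2 q3 qD); rewrite ?expf_neq0 ?circle //.
  apply: (mulfI f0); rewrite mulrA -F2_conj // mulrA {1 2}fxu -F2_conj //.
  by ring.
have x9 : x ^+ 9 = u ^+ 9.
  by move: fxu; rewrite !horner_F2 zw; apply: mulIf; apply: h_neq0.
(* The order of [x / u] divides both q - 1 and 9, which are coprime because q - 1 is 1 modulo 3. *)
have c1 : (x / u) ^+ (q - 1) = 1 by rewrite expr_div_n zw divff ?expf_neq0.
have c9 : (x / u) ^+ 9 = 1 by rewrite expr_div_n x9 divff ?expf_neq0.
have coprime_q : coprime (q - 1) 9.
  rewrite (@coprime_pexpr 2 (q - 1) 3) // coprime_sym prime_coprime //.
  by rewrite -eqn_mod_dvd // q3.
apply: (divIf u0); rewrite divff //.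
by rewrite -[LHS]expr1 -(eqP coprime_q) (expr_gcdn_eq1 c1 c9).
Qed.

Lemma F2_not_injective (F : finFieldType) (m q : nat) :
  q = (2 ^ m)%N -> #|F| = (q ^ 2)%N -> ~~ odd m ->
  ~ injective (fun x : F => (F2 F q).[x]).
Proof.
move=> hq hF em inj.
have q3 : (3 %| q - 1)%N by rewrite -eqn_mod_dvd ?hq ?expn_gt0 // pow2_even_mod3.
have [|u _ ou] := Cauchy (p := 3) (G := [set: {unit F}]%G) isT.
  rewrite card_finField_unit hF -subn1 -[X in (_ - X)%N](exp1n 2) subn_sqr.
  exact: dvdn_mulr.
have u3 : FinRing.uval u ^+ 3 = 1.
  by rewrite -FinRing.val_unitX -ou expg_order.
have [k Dk] := dvdnP q3.
suff /(congr1 (order)) : u = 1%g by rewrite ou order1.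
(* Since 3 divides q - 1, both [u] and 1 have (q-1)-th and 9th power 1, hence the same value 1 + 1 +
   1. *)
apply: val_inj; apply: inj; rewrite /= !horner_F2 expr1n Dk mulnC exprM u3.
by rewrite !expr1n (exprM _ 3 3) u3 expr1n.
Qed.

Theorem theorem3p3 (m q : nat) (F : finFieldType) (hm : (0 < m)%N)
    (hq : q = (2 ^ m)%N) (hF : #|F| = (q ^ 2)%N) :
  permutation_poly (F2 F q) <-> odd m.
Proof.
split=> [bij | om].
  by apply/idPn=> em; apply: (F2_not_injective hq hF em); apply: bij_inj.
by apply: injF_bij; apply: (F2_injective hq hF om).
Qed.
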